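(* Let $D$ be a finite simple digraph with at most one source and at most one sink. Then $\chi'_{vd}(D)=k(D)$, where $\chi'_{vd}(D)$ is the vertex-distinguishing chromatic index of $D$ and $$k(D)=\min\Big\{k\in\mathbb{N}\colon \binom{k}{d}\geq n_d^+(D)\text{ for all } d\in[\delta^+(D),\Delta^+(D)]\ \text{ and }\ \binom{k}{d}\geq n_d^-(D)\text{ for all } d\in[\delta^-(D),\Delta^-(D)]\Big\}.$$
   Context: All digraphs are finite and simple. For integers $p,q$, $[p,q]=\{i\in\mathbb{Z}\colon p\le i\le q\}$ and $[q]=[1,q]$. Here $\mathbb{N}$ denotes the nonnegative integers (and $[0]=\emptyset$). Let $D=(V(D),A(D))$ be a digraph; an arc $uv$ has tail $u$ and head $v$. For $v\in V(D)$, $d^+(v)$ and $d^-(v)$ are the outdegree and indegree of $v$; $\delta^+(D),\Delta^+(D)$ are the minimum and maximum outdegree, and $\delta^-(D),\Delta^-(D)$ the minimum and maximum indegree. For a nonnegative integer $d$, $n_d^+(D)$ and $n_d^-(D)$ are the numbers of vertices of outdegree $d$ and of indegree $d$, respectively. A source is a vertex with no in-arcs; a sink is a vertex with no out-arcs. An arc-$k$-coloring of $D$ is a mapping $\varphi\colon A(D)\to[k]$ such that no two distinct arcs with a common tail receive the same color and no two distinct arcs with a common head receive the same color (arcs $uv$ and $vw$ are allowed to receive the same color). For $v\in V(D)$, let $\varphi^+(v)=\{\varphi(vw)\colon vw\in A(D)\}$ (out-color set) and $\varphi^-(v)=\{\varphi(wv)\colon wv\in A(D)\}$ (in-color set). An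 arc-$k$-coloring $\varphi$ is vertex-distinguishing if $\varphi^+(u)\ne\varphi^+(v)$ and $\varphi^-(u)\neq\varphi^-(v)$ for every pair of distinct vertices $u,v\in V(D)$. The vertex-distinguishing chromatic index $\chi'_{vd}(D)$ is the minimum $k\in\mathbb{N}$ for which $D$ admits a vertex-distinguishing arc-$k$-coloring. (Such a $k$ exists if and only if $D$ has at most one source and at most one sink.) *)

(* Defs.v *)
From mathcomp Require Import all_boot.
Set Implicit Arguments.
Unset Strict Implicit.
Unset Printing Implicit Defensive.

(* Simple: no loops and no parallel arcs; opposite arcs uv and vu may coexist. *)
Record digraph := Digraph {
  vertex :> finType;
  arc : rel vertex;
  arc_irr : irreflexive arc
}.

Section Degrees.
Variable D : digraph.

Definition outdeg (v : D) : nat := #|[set w | arc v w]|.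
Definition indeg (v : D) : nat := #|[set w | arc w v]|.

(* Every degree is at most #|D|, so the default #|D| is only visible when D
   has no vertex; then the degree intervals below contain only 0. *)
Definition min_outdeg : nat := \big[minn/#|D|]_(v : D) outdeg v.
Definition max_outdeg : nat := \max_(v : D) outdeg v.
Definition min_indeg : nat := \big[minn/#|D|]_(v : D) indeg v.
Definition max_indeg : nat := \max_(v : D) indeg v.

Definition n_out (d : nat) : nat := #|[set v : D | outdeg v == d]|.
Definition n_in (d : nat) : nat := #|[set v : D | indeg v == d]|.

Definition sources : {set D} := [set v | [forall u, ~~ arc u v]].
Definition sinks : {set D} := [set v | [forall w, ~~ arc v w]].

Definition arcs := {a : D * D | arc a.1 a.2}.

Definition tail (a : arcs) : D := (val a).1.
Definition head (a : arcs) : D := (val a).2.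

End Degrees.

Section Coloring.
Variables (D : digraph) (k : nat).
Implicit Types (phi : {ffun arcs D -> 'I_k}) (v : D).

Definition arc_coloring phi : bool :=
  [forall a, forall b,
     (a != b) && ((tail a == tail b) || (head a == head b))
     ==> (phi a != phi b)].

Definition out_colors phi v : {set 'I_k} := [set phi a | a : arcs D & tail a == v].
Definition in_colors phi v : {set 'I_k} := [set phi a | a : arcs D & head a == v].

Definition vertex_distinguishing phi : bool :=
  [forall u, forall v, (u != v) ==>
     (out_colors phi u != out_colors phi v)
     && (in_colors phi u != in_colors phi v)].

Definition vd_colorable : bool :=
  [exists phi, arc_coloring phi && vertex_distinguishing phi].

Definition binomial_bounds : bool :=
  all (fun d => n_out D d <= 'C(k, d))
      (index_iota (min_outdeg D) (max_outdeg D).+1)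
  && all (fun d => n_in D d <= 'C(k, d))
         (index_iota (min_indeg D) (max_indeg D).+1).

End Coloring.

Section Minima.
Variable D : digraph.
Hypotheses (Dsource : #|sources D| <= 1) (Dsink : #|sinks D| <= 1).

(* Giving all arcs different colors is vertex-distinguishing. *)
Lemma ex_vd_colorable : exists k, vd_colorable D k.
Proof.
have no_out v : (forall a : arcs D, tail a != v) -> v \in sinks D.
  move=> noa; rewrite inE; apply/forallP=> w; apply/negP=> vw.
  by have /eqP[] := noa (exist _ (v, w) vw).
have no_in v : (forall a : arcs D, head a != v) -> v \in sources D.
  move=> noa; rewrite inE; apply/forallP=> w; apply/negP=> vw.
  by have /eqP[] := noa (exist _ (w, v) vw).
have key (f : arcs D -> D) (S : {set D}) u v : #|S| <= 1 ->
    (forall x, (forall a, f a != x) -> x \in S) ->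
    [set enum_rank a | a : arcs D & f a == u]
    = [set enum_rank a | a : arcs D & f a == v] -> u = v.
  move=> S1 fS eq_uv.
  have eqf a : (f a == u) = (f a == v).
    have := congr1 (fun A : {set _} => enum_rank a \in A) eq_uv.
    by rewrite !(mem_imset _ _ enum_rank_inj) !inE.
  case: (pickP (fun a => f a == u)) => [a fau | nou].
    by move: (fau); rewrite eqf => /eqP <-; rewrite (eqP fau).
  apply: (card_le1_eqP S1); apply: fS => a; by rewrite -?eqf nou.
have cE (f : arcs D -> D) v :
    [set [ffun a : arcs D => enum_rank a] a | a : arcs D & f a == v]
    = [set enum_rank a | a : arcs D & f a == v].
  by apply: eq_imset => a; rewrite ffunE.
exists #|{: arcs D}|; apply/existsP; exists [ffun a => enum_rank a].
apply/andP; split.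
  apply/forallP=> a; apply/forallP=> b; apply/implyP=> /andP[ab _].
  by rewrite !ffunE (inj_eq enum_rank_inj).
apply/forallP=> u; apply/forallP=> v; apply/implyP=> uv.
rewrite /out_colors /in_colors !cE.
apply/andP; split; apply: contra uv => /eqP.
  by move/(key _ _ _ _ Dsink no_out) => ->.
by move/(key _ _ _ _ Dsource no_in) => ->.
Qed.

Lemma leq_bin_self n d : 0 < d < n -> n <= 'C(n, d).
Proof.
elim: n d => [|n IHn] [|d] //=; rewrite ltnS => dn.
rewrite binS; case: (ltnP d.+1 n) => [dn' | nd].
  by rewrite -addn1 leq_add ?IHn // bin_gt0 ltnW // ltnW.
have -> : n = d.+1 by apply/eqP; rewrite eqn_leq nd dn.
by rewrite binn binSn.
Qed.

Lemma ex_binomial_bounds : exists k, binomial_bounds D k.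
Proof.
have deg0 (A : {set D}) : (#|A| == 0) = [forall w, w \notin A].
  rewrite cards_eq0; apply/eqP/forallP => [-> w | nA]; first by rewrite inE.
  by apply/setP=> w; rewrite inE (negPf (nA w)).
have n0out : n_out D 0 <= 1.
  apply: leq_trans Dsink; rewrite subset_leq_card //.
  apply/subsetP=> v; rewrite !inE deg0 => /forallP h; apply/forallP => w.
  by have := h w; rewrite inE.
have n0in : n_in D 0 <= 1.
  apply: leq_trans Dsource; rewrite subset_leq_card //.
  apply/subsetP=> v; rewrite !inE deg0 => /forallP h; apply/forallP => w.
  by have := h w; rewrite inE.
have big d (n : nat) : (d = 0 -> n <= 1) -> n <= #|D| -> d <= #|D| ->
    n <= 'C(#|D|.+1, d).
  case: d => [|d] n1 nD dD; first by rewrite bin0 n1.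
  by apply: (leq_trans nD); apply: (leq_trans (leqnSn _)); apply: leq_bin_self.
exists #|D|.+1; apply/andP; split; apply/allP=> d;
  rewrite mem_index_iota ltnS => /andP[_ dle]; apply: big;
  rewrite ?max_card //; try by move=> ->.
  by apply: (leq_trans dle); apply/bigmax_leqP => v _; exact: max_card.
by apply: (leq_trans dle); apply/bigmax_leqP => v _; exact: max_card.
Qed.

Definition chi_vd : nat := ex_minn ex_vd_colorable.
Definition k_bound : nat := ex_minn ex_binomial_bounds.

End Minima.

(* Main.v *)
Require Import Defs.
From mathcomp Require Import all_boot perm zify.

(** Splitting every vertex v into an out-copy and an in-copy turns arcs into the
    edges of a bipartite graph, and an arc-coloring into a proper edge coloring;
    the out-color sets must be distinct on one side, the in-color sets on the
    other.  The sides are indexed by a boolean.  If such a coloring with k colors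
    exists, the n_d vertices of degree d on a side receive n_d different d-subsets
    of the k colors, so n_d <= 'C(k, d) ([vd_colorableE]).

    For the converse, fix a proper k-edge-coloring and let n(S) be the number of
    vertices of a given side with color set S.  Take two colors i and j.  The edges
    with these colors form Kempe chains, which are paths and even cycles.  A
    vertex that sees exactly one of i, j is an end of a path; its color set is T+i
    or T+j, where T contains neither color.  On each side and for each such T,
    match as many (T+i)-vertices as possible with (T+j)-vertices and identify the
    matched ends.  The two-colored graph still consists of paths and cycles, and
    its ends now sit only at classes T with n(T+i) != n(T+j), always on the more
    frequent color.  Exchanging i and j along one path therefore moves one vertex
    from the larger to the smaller of n(T+i), n(T+j) at each of its two ends, and
    changes no other n(S).  Colors alternate along a path and sides alternate
    along an edge, so two ends on the same side have different colors: if one end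
    moves a unit from i to j, another end on the same side moves one from j to i
    ([transfer], [set_transfer]).

    No such move increases the sum of all n(S)^2, and it strictly decreases it if
    n(T+i) >= n(T+j) + 2 ([energy_transfer]).  Suppose that n(S) >= 2 for some S.
    By the binomial bound a set S' of the same size has n(S') = 0.  With i in
    S \ S' and j in S' \ S, the set S-i+j is closer to S'.  Either it is
    repeated already, or the move makes it repeated or decreases the sum of
    squares; the hole S' survives, because filling it would mean moving a second
    unit on this side from i to j.  Repeating this brings the repeated set next to
    the hole, where the move decreases the sum ([energy_descent]).  A proper
    coloring with the least sum thus has all n(S) <= 1.

    The initial proper coloring (König's theorem) comes from the same move, with
    the vertices themselves as classes: an improper coloring has a vertex with two
    edges of color i and none of color j ([proper_coloring_exists]). *)

Set Implicit Arguments.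
Unset Strict Implicit.
Unset Printing Implicit Defensive.

(** * Alternating paths *)

(** From the fixed point [d0] of [tau], apply [rho] and [tau] in turn.  The walk
    follows a path until [rho] leads to a second fixed point [d1] of [tau], and
    then runs back.  An odd number of sign changes separates the two ends.  The
    set [A] consists of the points of this path. *)
Lemma alternating_path (X : finType) (rho tau : X -> X) (sgn : X -> bool)
    (P : {pred X}) (d0 : X) :
  involutive rho -> involutive tau ->
  (forall x, sgn (rho x) = ~~ sgn x) ->
  (forall x, tau x != x -> sgn (tau x) = ~~ sgn x) ->
  (forall x, x \in P -> rho x \in P) -> (forall x, x \in P -> tau x \in P) ->
  tau d0 = d0 -> d0 \in P ->
  exists (A : {set X}) (d1 : X),
    [/\ forall x, (rho x \in A) = (x \in A),
        forall x, (tau x \in A) = (x \in A),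
        {subset A <= P}, sgn d1 = ~~ sgn d0
      & [set x in A | tau x == x] = [set d0; d1]].
Proof.
move=> rhoK tauK sgn_rho sgn_tau Prho Ptau fix_d0 Pd0.
pose p := tau \o rho; pose d t := iter t p d0.
have p_inj : injective p := inj_comp (inv_inj tauK) (inv_inj rhoK).
have dS t : d t.+1 = tau (rho (d t)) by [].
have tau_dS t : tau (d t.+1) = rho (d t) by rewrite dS tauK.
(* The injective map p returns to d0: some x on the walk has tau (rho x) = d0,
   so rho x = tau d0 = d0 is fixed by tau. *)
have ex_end : exists t, tau (rho (d t)) == rho (d t).
  exists (order p d0).-1; rewrite -dS -tau_dS /d prednK ?order_gt0 //.
  by rewrite iter_order // fix_d0.
case: (ex_minnP ex_end) => m /eqP end_m min_m {ex_end}.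
have not_end t : t < m -> tau (rho (d t)) != rho (d t).
  by move=> tm; apply: contraL tm => /min_m; rewrite -leqNgt.
have not_fix t : t < m -> tau (d t.+1) != d t.+1.
  by move=> tm; rewrite tau_dS dS eq_sym not_end.
have sgn_d t : t <= m -> sgn (d t) = sgn d0.
  elim: t => // t IHt tm.
  by rewrite dS sgn_tau ?not_end // sgn_rho negbK IHt // ltnW.
have [A inA] : {A : {set X} & forall x,
    reflect (exists2 t, t <= m & x = d t \/ x = rho (d t)) (x \in A)}.
  exists [set x | [exists t : 'I_m.+1, (x == d t) || (x == rho (d t))]].
  move=> x; rewrite inE; apply: (iffP existsP) => [[t /orP tP] | [t tm tP]].
    by exists t; [rewrite -ltnS | case: tP => /eqP ->; [left | right]].
  exists (Ordinal (tm : t < m.+1)).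
  by case: tP => ->; rewrite eqxx ?orbT.
have Arho x : x \in A -> rho x \in A.
  move=> /inA[t tm xE]; apply/inA; exists t => //.
  by case: xE => ->; [right | left; rewrite rhoK].
have Atau x : x \in A -> tau x \in A.
  move=> /inA[t tm [] ->].
    case: t tm => [|t] tm; last by apply/inA; exists t; [exact: ltnW | right].
    by rewrite fix_d0; apply/inA; exists 0; [| left].
  move: tm; rewrite leq_eqVlt => /predU1P[-> | tm].
    by rewrite end_m; apply/inA; exists m; [| right].
  by apply/inA; exists t.+1; [| left].
exists A, (rho (d m)); split.
- by move=> x; apply/idP/idP=> [/Arho | /Arho //]; rewrite rhoK.
- by move=> x; apply/idP/idP=> [/Atau | /Atau //]; rewrite tauK.
- have Pd t : d t \in P by elim: t => // t IHt; apply/Ptau/Prho.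
  by move=> x /inA[t _ [] ->]; rewrite ?Prho.
- by rewrite sgn_rho sgn_d.
apply/setP=> x; rewrite !inE; apply/andP/orP => [[/inA[t tm xE] fix_x] | ].
  case: xE fix_x => ->.
    case: t tm => [|t] tm; first by left.
    by rewrite (negPf (not_fix t tm)).
  move: tm; rewrite leq_eqVlt => /predU1P[-> | tm]; first by right.
  by rewrite (negPf (not_end t tm)).
case=> /eqP ->; rewrite ?fix_d0 ?end_m eqxx; split=> //; apply/inA.
  by exists 0; [| left].
by exists m; [| right].
Qed.

(** * Maximal matchings between two classes *)

(** The k-th element of [A] is exchanged with the k-th element of [B]; the default
    of [nth] leaves the surplus of the larger set fixed. *)
Definition mate (E : finType) (A B : {set E}) (e : E) : E :=
  if e \in A then nth e (enum B) (index e (enum A))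
  else if e \in B then nth e (enum A) (index e (enum B)) else e.

Lemma mateC (E : finType) (A B : {set E}) e :
  [disjoint A & B] -> mate A B e = mate B A e.
Proof. by move=> /disjointFr AB; rewrite /mate; case: ifP => // /AB ->. Qed.

Lemma mate_in (E : finType) (A B : {set E}) e :
  e \in A -> (mate A B e == e) || (mate A B e \in B).
Proof.
rewrite /mate => eA; rewrite eA.
case: (ltnP (index e (enum A)) (size (enum B))) => h.
  by rewrite -(mem_enum B) mem_nth ?orbT.
by rewrite nth_default ?eqxx.
Qed.

Lemma mateK (E : finType) (A B : {set E}) :
  [disjoint A & B] -> involutive (mate A B).
Proof.
move=> AB0.
have half (C D : {set E}) e : [disjoint C & D] -> e \in C ->
    mate C D (mate C D e) = e.
  move=> CD eC; rewrite [X in mate C D X]/mate eC.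
  case: (ltnP (index e (enum C)) (size (enum D))) => h; last first.
    by rewrite nth_default // /mate eC nth_default.
  set f := nth _ _ _; have fD : f \in D by rewrite -mem_enum mem_nth.
  rewrite /mate (disjointFl CD fD) fD index_uniq ?enum_uniq //.
  by rewrite nth_index // mem_enum.
move=> e; case: (boolP (e \in A)) => eA; first exact: half.
case: (boolP (e \in B)) => eB.
  by rewrite !(mateC _ AB0) half // disjoint_sym.
by rewrite /mate (negPf eA) (negPf eB) (negPf eA) (negPf eB).
Qed.

Lemma mate_fixed_lt (E : finType) (A B : {set E}) e :
  [disjoint A & B] -> e \in A -> mate A B e = e -> #|B| < #|A|.
Proof.
move=> AB0 eA; rewrite /mate eA => fix_e.
have lt_A : index e (enum A) < #|A| by rewrite cardE index_mem mem_enum.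
apply: leq_trans lt_A; rewrite ltnS cardE leqNgt; apply/negP => h.
have : e \in B by rewrite -fix_e -mem_enum mem_nth.
by rewrite (disjointFr AB0 eA).
Qed.

Lemma mate_fixed_ex (E : finType) (A B : {set E}) :
  #|B| < #|A| -> exists2 e, e \in A & mate A B e = e.
Proof.
move=> lt_BA; have /card_gt0P[e0 _] : 0 < #|A| by apply: leq_trans lt_BA.
pose e := nth e0 (enum A) #|B|.
have eA : e \in A by rewrite -mem_enum mem_nth // -cardE.
exists e => //; rewrite /mate eA nth_default // /e index_uniq -?cardE //.
exact: enum_uniq.
Qed.

(** * Moving one unit along a path *)

(** A pair [(s, e)] is the end on side [s] of the edge [e].  The function [g] sorts
    the ends into classes. *)
Definition key (E G C : Type) (g : bool -> E -> G) (c : E -> C)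
    (d : bool * E) : bool * G * C :=
  (d.1, g d.1 d.2, c d.2).

Definition load (E : finType) (G C : eqType) (g : bool -> E -> G) (c : E -> C)
    (y : bool * G * C) : nat :=
  #|[set d | key g c d == y]|.

Section Load.
Variables (E : finType) (G C : eqType) (g : bool -> E -> G) (c : E -> C).

Definition fibre (s : bool) (x : G) (a : C) : {set E} :=
  [set e | (g s e == x) && (c e == a)].

Lemma load_fibre s x a : load g c (s, x, a) = #|fibre s x a|.
Proof.
have pairI : injective (pair s : E -> bool * E) by move=> e f [].
rewrite -(card_imset _ pairI) /load; apply: eq_card => -[s' e].
rewrite !inE /key /= !xpair_eqE; apply/idP/imsetP=> [|[f fF [-> ->]]].
  by case/andP=> /andP[/eqP -> ge] ce; exists e; rewrite // inE ge ce.
by move: fF; rewrite inE eqxx.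
Qed.

Lemma load_sum y : load g c y = \sum_d (key g c d == y).
Proof. by rewrite /load -sum1dep_card big_mkcond. Qed.

End Load.

(** Identify the ends of [i]-edges with ends of [j]-edges in the same class, as far
    as possible, and exchange [i] and [j] along the path that starts at a surplus
    [i]-end of the class [(s0, x0)].  The path ends at another surplus end.  The
    sign of an end, its side combined with whether its color is [i], changes
    between the two ends of an edge and between identified ends.  Hence the ends
    of the path have opposite signs, which determines the surplus color [a1] at
    the second end. *)
Lemma transfer (E C : finType) (G : eqType) (g : bool -> E -> G)
    (c : {ffun E -> C}) (i j : C) (s0 : bool) (x0 : G) :
  i != j -> load g c (s0, x0, j) < load g c (s0, x0, i) ->
  exists (c' : {ffun E -> C}) (s1 : bool) (x1 : G),
    let a1 := if s1 == s0 then j else i in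
    let b1 := if s1 == s0 then i else j in
    [/\ forall e, c' e = c e \/ c' e = tperm i j (c e),
        (s1, x1) != (s0, x0),
        load g c (s1, x1, b1) < load g c (s1, x1, a1)
      & forall y,
          load g c' y + (y == (s0, x0, i)) + (y == (s1, x1, a1)) =
          load g c y + (y == (s0, x0, j)) + (y == (s1, x1, b1))].
Proof.
move=> ij lt0; pose F s x a := fibre g c s x a.
have F_dis s x : [disjoint F s x i & F s x j].
  rewrite -setI_eq0; apply/eqP/setP=> e; rewrite !inE.
  by case: (c e =P i) => [-> | _]; rewrite ?(negPf ij) !andbF.
pose m s x := mate (F s x i) (F s x j).
pose rho (d : bool * E) := (~~ d.1, d.2).
pose tau (d : bool * E) := (d.1, m d.1 (g d.1 d.2) d.2).
pose sgn (d : bool * E) := d.1 (+) (c d.2 == i).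
have tauP d : (tau d = d) \/ [/\ g d.1 (tau d).2 = g d.1 d.2,
    c d.2 \in [:: i; j] & c (tau d).2 = tperm i j (c d.2)].
  case: d => s e; rewrite /tau /m /=; set x := g s e.
  case: (boolP (e \in F s x i)) => [eI | eI].
    case/orP: (mate_in (F s x j) eI) => [/eqP -> | ]; first by left.
    move: eI; rewrite !inE eqxx /= => /eqP -> /andP[/eqP -> /eqP ->].
    by right; rewrite tpermL eqxx.
  case: (boolP (e \in F s x j)) => [eJ | eJ]; last first.
    by rewrite /mate (negPf eI) (negPf eJ); left.
  rewrite mateC //; case/orP: (mate_in (F s x i) eJ) => [/eqP -> | ].
    by left.
  move: eJ; rewrite !inE eqxx /= => /eqP -> /andP[/eqP -> /eqP ->].
  by right; rewrite tpermR eqxx orbT.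
have rhoK : involutive rho by case=> s e; rewrite /rho /= negbK.
have tauK : involutive tau.
  move=> d; case: (tauP d) => [td | [gt _ _]]; first by rewrite !td.
  by rewrite {1}/tau /= gt /m mateK //; case: (d).
have sgn_rho d : sgn (rho d) = ~~ sgn d by rewrite /sgn addNb.
have sgn_tau d : tau d != d -> sgn (tau d) = ~~ sgn d.
  case: (tauP d) => [-> | [_ cd ct]]; first by rewrite eqxx.
  move=> _; rewrite /sgn ct -addbN; congr (_ (+) _).
  move: cd; rewrite !inE => /orP[] /eqP ->.
    by rewrite tpermL eqxx eq_sym (negPf ij).
  by rewrite tpermR eqxx eq_sym (negPf ij).
pose P := [pred d : bool * E | c d.2 \in [:: i; j]].
have Prho d : d \in P -> rho d \in P by [].
have Ptau d : d \in P -> tau d \in P.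
  case: (tauP d) => [-> // | [_ cd ct] _]; move: cd; rewrite !inE ct.
  by case/orP=> /eqP ->; rewrite ?tpermL ?tpermR eqxx ?orbT.
have [e0 e0I fix0] : exists2 e, e \in F s0 x0 i & m s0 x0 e = e.
  by apply: mate_fixed_ex; rewrite -!load_fibre.
move: (e0I); rewrite inE => /andP[/eqP ge0 /eqP ce0].
have fixd0 : tau (s0, e0) = (s0, e0) by rewrite /tau /= ge0 fix0.
have Pd0 : (s0, e0) \in P by rewrite !inE ce0 eqxx.
have [A [[s1 e1] [Arho Atau AP sgn1 fixA]]] :=
  alternating_path rhoK tauK sgn_rho sgn_tau Prho Ptau fixd0 Pd0.
have /setIdP[d1A /eqP[fix1]] : (s1, e1) \in [set x in A | tau x == x].
  by rewrite fixA !inE eqxx orbT.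
set x1 := g s1 e1 in fix1.
pose a1 := if s1 == s0 then j else i; pose b1 := if s1 == s0 then i else j.
have ce1 : c e1 = a1.
  move: sgn1 (AP _ d1A); rewrite /sgn /= ce0 eqxx !inE /= /a1 => sgn1.
  case/orP=> /eqP ce1; move: sgn1; rewrite ce1 ?eqxx 1?[j == i]eq_sym ?(negPf ij);
    by case: (s0); case: (s1).
have swap1 : tperm i j a1 = b1.
  by rewrite /a1 /b1; case: (s1 == s0); rewrite ?tpermL ?tpermR.
have e1F : e1 \in F s1 x1 a1 by rewrite inE ce1 !eqxx.
have lt1 : load g c (s1, x1, b1) < load g c (s1, x1, a1).
  rewrite !load_fibre; move: fix1 e1F; rewrite /m /a1 /b1.
  case: (s1 == s0) => fix1 e1F; last exact: (mate_fixed_lt (F_dis _ _) e1F).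
  by apply: mate_fixed_lt e1F _; rewrite 1?mateC // disjoint_sym.
have neq01 : (s1, x1) != (s0, x0).
  apply/eqP=> -[s10 x10]; move: lt1; rewrite /a1 /b1 s10 eqxx x10.
  by rewrite ltnNge ltnW.
exists [ffun e => if (true, e) \in A then tperm i j (c e) else c e], s1, x1.
rewrite -/a1 -/b1; split=> // [e | y].
  by rewrite ffunE; case: ifP; [right | left].
set c' := [ffun e => _].
have inA s e : ((true, e) \in A) = ((s, e) \in A) by case: s; rewrite // -Arho.
have key_swap d : d \in A -> key g c' d = (d.1, g d.1 d.2, tperm i j (c d.2)).
  by case: d => s e dA; rewrite /key ffunE (inA s) dA.
have d01 : (s0, e0) != (s1, e1).
  by apply/eqP=> d01; move: sgn1; rewrite -d01; case: (sgn _).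
have d0A : (s0, e0) \in A.
  suff /setIdP[] : (s0, e0) \in [set x in A | tau x == x] by [].
  by rewrite fixA !inE eqxx.
(* Recoloring gives an end of A the key that its partner under tau had; only the
   two unmatched ends contribute to a change. *)
have sumA (f : bool * E -> bool * G * C) : \sum_d (f d == y) =
    \sum_(d in A | tau d != d) (f d == y) + \sum_(d | d \notin A) (f d == y)
    + ((y == f (s0, e0)) + (y == f (s1, e1))).
  rewrite (bigID (mem A)) /= (bigID (fun d => tau d == d)) /=.
  rewrite -addnA addnC; congr (_ + _).
  rewrite (eq_bigl (mem [set (s0, e0); (s1, e1)])) => [|d]; last first.
    by rewrite -fixA [RHS]inE.
  by rewrite big_setU1 ?inE //= big_set1 ![y == _]eq_sym.
rewrite !load_sum !sumA.
have -> : \sum_(d | d \notin A) (key g c' d == y) =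
          \sum_(d | d \notin A) (key g c d == y).
  apply: eq_bigr => -[s e] dA; rewrite /key ffunE (inA s) /=.
  by rewrite (negPf dA).
have -> : \sum_(d in A | tau d != d) (key g c' d == y) =
          \sum_(d in A | tau d != d) (key g c d == y).
  rewrite [RHS](reindex_inj (inv_inj tauK)) /=.
  apply: eq_big => [d | d /andP[dA td]]; first by rewrite Atau tauK eq_sym.
  rewrite key_swap //; case: (tauP d) td => [-> | [gt _ ct] _].
    by rewrite eqxx.
  by rewrite /key gt ct.
rewrite !key_swap // /key /= ge0 ce0 ce1 swap1 tpermL -/x1.
by rewrite -[LHS]addnA addnAC addnA.
Qed.

(** * Counting and the sum of squares *)

Lemma card_sum_fibres (I J : finType) (D : {set I}) (h : I -> J) (B : {set J}) :
  {in D, forall x, h x \in B} ->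
  \sum_(y in B) #|[set x in D | h x == y]| = #|D|.
Proof.
move=> hB; rewrite -[RHS]sum1_card (partition_big h (mem B)) //=.
by apply: eq_bigr => y _; rewrite sum1dep_card.
Qed.

Lemma exists_hole (I : finType) (B : {set I}) (f : I -> nat) x :
  \sum_(y in B) f y <= #|B| -> x \in B -> 1 < f x ->
  exists2 y, y \in B & f y = 0.
Proof.
move=> leB xB fx; case: (pickP [pred y in B | f y == 0]) => [y | no0].
  by case/andP=> yB /eqP; exists y.
suff : #|B| < \sum_(y in B) f y by rewrite ltnNge leB.
rewrite -sum1_card (bigD1 x) //= [X in _ < X](bigD1 x) //=.
rewrite -addSn leq_add // leq_sum // => y /andP[yB _].
by move: (no0 y); rewrite /= yB /= lt0n => ->.
Qed.

Definition energy (Y : finType) (f : Y -> nat) : nat := \sum_y f y ^ 2.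

(** Moving a unit from a value x to a smaller value y changes the sum of squares by
    2(y - x + 1).  The side conditions exclude a value that changes by two. *)
Lemma energy_transfer (Y : finType) (f f' : Y -> nat) (p0 q0 p1 q1 : Y) :
  f q0 < f p0 -> f q1 < f p1 -> p0 != p1 -> q0 != q1 ->
  (forall y, f' y + (y == p0) + (y == p1) = f y + (y == q0) + (y == q1)) ->
  energy f' + (f p0 - f q0).-1 <= energy f.
Proof.
move=> lt0 lt1 p01 q01 f'E.
have at_pt (h : Y -> nat) p : \sum_y h y * (y == p) = h p.
  rewrite (bigD1 p) //= eqxx muln1 big1 ?addn0 // => y /negPf ->.
  by rewrite muln0.
have at1 p : \sum_y (y == p) = 1 :> nat.
  by rewrite (bigD1 p) //= eqxx big1 // => y /negPf ->.
have : \sum_y (f' y ^ 2 + 2 * (f y * (y == p0) + f y * (y == p1))) <=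
       \sum_y (f y ^ 2 + 2 * (f y * (y == q0) + f y * (y == q1))
         + ((y == p0) + (y == p1) + ((y == q0) + (y == q1)))).
  apply: leq_sum => y _; move: (f'E y).
  have : ~~ ((y == p0) && (y == p1)).
    by apply: contra p01 => /andP[/eqP <- /eqP <-].
  have : ~~ ((y == q0) && (y == q1)).
    by apply: contra q01 => /andP[/eqP <- /eqP <-].
  case: (y == p0); case: (y == p1) => //=;
    case: (y == q0); case: (y == q1) => //= _ _; rewrite !expnS expn0; nia.
rewrite !big_split /= !big1_eq !at_pt !at1 -/(energy f) -/(energy f').
lia.
Qed.

(** * Proper edge colorings of bipartite multigraphs *)

Section Bipartite.
Variables (E V : finType) (ends : bool -> E -> V).

Definition edge_proper (C : eqType) (c : E -> C) : Prop :=
  forall s e f, ends s e = ends s f -> c e = c f -> e = f.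

Lemma edge_properP (C : eqType) (c : E -> C) :
  (forall y, load ends c y <= 1) <-> edge_proper c.
Proof.
split=> [load1 s e f ef cef | cP [[s v] a]].
  have /card_le1_eqP eqF := load1 (s, ends s e, c e).
  suff [] : (s, e) = (s, f) by [].
  by apply: eqF; rewrite inE /key /= ?ef ?cef.
rewrite load_fibre; apply/card_le1_eqP => e f.
rewrite !inE => /andP[/eqP es /eqP ce] /andP[/eqP fs /eqP cf].
by apply: (cP s); rewrite ?es ?ce.
Qed.

(** König's edge-coloring theorem: a coloring that minimizes the sum of the squared
    loads is proper, since a vertex with two edges of color [i] misses some color
    [j], and [transfer] from [i] to [j] at this vertex decreases the sum. *)
Lemma proper_coloring_exists (k : nat) :
  (forall s v, #|[set e | ends s e == v]| <= k) ->
  exists c : {ffun E -> 'I_k}, edge_proper c.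
Proof.
move=> degk; have [c0] : exists c : {ffun E -> 'I_k}, true.
  case: k degk => [|k] degk; last by exists [ffun=> ord0].
  have noE (e : E) : False.
    have := degk true (ends true e); rewrite leqn0 cards_eq0 => /eqP /setP/(_ e).
    by rewrite !inE eqxx.
  by exists (finfun (fun e => match noE e with end)).
have [n] := ubnP (energy (load ends c0)); elim: n c0 => // n IHn c le_n _.
case: (boolP [forall y, load ends c y <= 1]) => [/forallP load1 | ].
  by exists c; apply/edge_properP.
rewrite negb_forall => /existsP[[[s v] i]]; rewrite -ltnNge => load_i.
have [j _ load_j] : exists2 j, j \in [set: 'I_k] & load ends c (s, v, j) = 0.
  apply: (exists_hole _ (in_setT i) load_i); rewrite cardsT card_ord.
  apply: leq_trans (degk s v); rewrite -(card_sum_fibres (h := c) (B := setT)) //.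
  apply: eq_leq; apply: eq_bigr => a _; rewrite load_fibre.
  by apply: eq_card => e; rewrite !inE.
have ij : i != j by apply: contraTneq load_i => ->; rewrite load_j.
have [|c' [s1 [v1]]] := @transfer _ _ _ ends c i j s v ij.
  by rewrite load_j ltnW.
set a1 := if _ then j else i; set b1 := if _ then i else j.
move=> [_ neq1 lt1 loadE]; apply: (IHn c') => //.
move: le_n; rewrite ltnS; apply: leq_trans.
apply: leq_trans (energy_transfer _ lt1 _ _ loadE); last 3 first.
- by rewrite load_j ltnW.
- by apply: contra neq1 => /eqP[-> -> _].
- by apply: contra neq1 => /eqP[-> -> _].
by rewrite load_j subn0 -[ltnLHS]addn0 ltn_add2l ltn_predRL.
Qed.

(** * Moving one unit between color sets *)

Section ColorSets.
Variable C : finType.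
Implicit Types (c : {ffun E -> C}) (S Q : {set C}) (s : bool) (v : V).

Definition colors c s v : {set C} := [set c e | e : E & ends s e == v].

Definition mult c (y : bool * {set C}) : nat :=
  #|[set v | colors c y.1 v == y.2]|.

Lemma colorsP c s v a :
  reflect (exists2 e, ends s e = v & c e = a) (a \in colors c s v).
Proof.
apply: (iffP imsetP) => [[e] | [e es ce]].
  by rewrite inE => /eqP es ->; exists e.
by exists e; rewrite // inE es.
Qed.

Lemma card_colors c s v : edge_proper c ->
  #|colors c s v| = #|[set e | ends s e == v]|.
Proof.
move=> cP; rewrite [LHS]card_in_imset ?cardsE // => e f.
by rewrite !inE => /eqP es /eqP fs; apply: (cP s); rewrite es.
Qed.

(** A symmetric relation, so that facts about [c] and [c'] need only one
    direction. *)
Definition recolors Q c c' : Prop :=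
  forall e, c' e = c e \/ (c e \in Q) && (c' e \in Q).

Lemma recolors_sym Q c c' : recolors Q c c' -> recolors Q c' c.
Proof. by move=> cc' e; case: (cc' e) => [-> | /andP[-> ->]]; [left | right]. Qed.

Lemma recolors_refl Q c : recolors Q c c.
Proof. by left. Qed.

Lemma recolors_in Q c c' e : recolors Q c c' -> (c' e \in Q) = (c e \in Q).
Proof. by move=> /(_ e)[-> | /andP[-> ->]]. Qed.

Lemma recolors_setD Q c c' s v :
  recolors Q c c' -> colors c' s v :\: Q = colors c s v :\: Q.
Proof.
move=> cc'; apply/setP=> a; rewrite !inE; case: (boolP (a \in Q)) => //= aQ.
apply/colorsP/colorsP=> -[e es ce]; exists e => //;
  by case: (cc' e) => [|]; [congruence | rewrite ce (negPf aQ) ?andbF].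
Qed.

Lemma recolors_cardI Q c c' s v :
  edge_proper c -> edge_proper c' -> recolors Q c c' ->
  #|colors c' s v :&: Q| = #|colors c s v :&: Q|.
Proof.
move=> cP c'P cc'.
have half (d : {ffun E -> C}) : edge_proper d -> recolors Q c d ->
    #|colors d s v :&: Q| = #|[set e | (ends s e == v) && (c e \in Q)]|.
  move=> dP cd; rewrite -(card_in_imset (f := d)) => [|e f]; last first.
    rewrite !inE => /andP[/eqP es _] /andP[/eqP fs _].
    by apply: (dP s); rewrite es.
  apply: eq_card => a; rewrite inE; apply/andP/imsetP.
    case=> /colorsP[e es ce] aQ; exists e => //.
    by rewrite inE es eqxx -(recolors_in _ cd) ce.
  case=> e; rewrite inE => /andP[/eqP es ce] ->.
  by rewrite (recolors_in _ cd) ce; split=> //; apply/colorsP; exists e.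
by rewrite !half //; apply: recolors_refl.
Qed.

Lemma setDI_inj Q S S' : S :\: Q = S' :\: Q -> S :&: Q = S' :&: Q -> S = S'.
Proof. by move=> eD eI; rewrite -(setID S Q) eD eI setID. Qed.

(** A vertex that sees all of [Q] or none of it keeps its color set, because the
    number of its edges with colors in [Q] does not change. *)
Lemma recolors_mult Q c c' s S :
  edge_proper c -> edge_proper c' -> recolors Q c c' ->
  #|S :&: Q| \in [:: 0; #|Q|] -> mult c' (s, S) = mult c (s, S).
Proof.
have sub (d d' : {ffun E -> C}) v :
    edge_proper d -> edge_proper d' -> recolors Q d d' ->
    #|S :&: Q| \in [:: 0; #|Q|] -> colors d s v = S -> colors d' s v = S.
  move=> dP d'P dd' cardQ dS; apply: (@setDI_inj Q).
    by rewrite (recolors_setD _ _ dd') dS.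
  have := recolors_cardI s v dP d'P dd'; rewrite dS.
  move: cardQ; rewrite !inE => /orP[] /eqP SQ; rewrite SQ => d'Q.
    by rewrite (cards0_eq SQ) (cards0_eq d'Q).
  have full T : #|T :&: Q| = #|Q| -> T :&: Q = Q.
    by move=> cT; apply/eqP; rewrite eqEcard subsetIr cT leqnn.
  by rewrite (full _ d'Q) (full _ SQ).
move=> cP c'P cc' cardQ; apply: eq_card => v; rewrite !inE /=.
by apply/eqP/eqP; apply: sub => //; apply: recolors_sym.
Qed.

(** For [Q] a pair of colors, a vertex that sees both is a class by itself: its two
    edges stay consecutive on their path.  The other vertices are put together
    when their color sets agree outside [Q]. *)
Definition virtual_end Q c s e : V + {set C} :=
  let T := colors c s (ends s e) in
  if Q \subset T then inl (ends s e) else inr (T :\: Q).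

(** A vertex that sees exactly one color [a] of the pair [Q] has exactly one edge
    with a color in [Q].  So vertices with color set [S] correspond to ends of
    color [a] in the class of [S :\: Q], also after a recoloring, although the
    classes are those of the first coloring. *)
Lemma mult_load Q c c' s S a :
  edge_proper c -> edge_proper c' -> recolors Q c c' ->
  #|Q| = 2 -> S :&: Q = [set a] ->
  mult c' (s, S) = load (virtual_end Q c) c' (s, inr (S :\: Q), a).
Proof.
move=> cP c'P cc' Q2 SQ.
have [aS aQ] : a \in S /\ a \in Q by apply/setIP; rewrite SQ set11.
have notQ v T : #|T :&: Q| <= 1 -> (Q \subset T) = false.
  by move=> T1; apply: contraTF T1 => /setIidPr ->; rewrite Q2.
rewrite load_fibre -(card_in_imset (f := ends s)) => [|e f]; last first.
  rewrite !inE => /andP[_ /eqP ce] /andP[_ /eqP cf] ef.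
  by apply: c'P ef _; rewrite ce cf.
apply: eq_card => v; rewrite inE /=; apply/eqP/imsetP => [c'S | [e]].
  have /colorsP[e es ce] : a \in colors c' s v by rewrite c'S.
  exists e => //; rewrite inE ce eqxx andbT /virtual_end es notQ //.
    by rewrite -(recolors_setD _ _ cc') c'S.
  by rewrite -(recolors_cardI _ _ cP c'P cc') c'S SQ cards1.
rewrite inE /virtual_end => /andP[]; case: ifP => // NQ /eqP[eD] /eqP ce ->.
apply: (@setDI_inj Q); first by rewrite (recolors_setD _ _ cc').
rewrite SQ; apply/eqP; rewrite eq_sym eqEcard cards1 sub1set inE aQ andbT.
apply/andP; split; first by apply/colorsP; exists e.
rewrite (recolors_cardI _ _ cP c'P cc') -ltnS -Q2 ltnNge.
apply: contraFN NQ => Qle; apply/setIidPl/eqP; rewrite setIC.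
by rewrite eqEcard subsetIr.
Qed.

(** The move of [transfer] for the classes [virtual_end].  A vertex that sees both
    colors is a balanced class, hence no end of the path: it still sees both
    colors afterwards, so the coloring stays proper, and what moves is the color
    set of a vertex at each end. *)
Lemma set_transfer c (i j : C) (s0 : bool) S :
  let Q := [set i; j] in let swap S := tperm i j @: S in
  edge_proper c -> i != j -> S :&: Q = [set i] ->
  mult c (s0, swap S) < mult c (s0, S) ->
  exists (c' : {ffun E -> C}) (s1 : bool) (S1 : {set C}),
    [/\ edge_proper c',
        S1 :&: Q = [set if s1 == s0 then j else i],
        mult c (s1, swap S1) < mult c (s1, S1)
      & forall y,
          mult c' y + (y == (s0, S)) + (y == (s1, S1)) =
          mult c y + (y == (s0, swap S)) + (y == (s1, swap S1))].
Proof.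
move=> Q swap cP ij SQ lt0.
have Q2 : #|Q| = 2 by rewrite cards2 ij.
have iQ : i \in Q by rewrite !inE eqxx.
have jQ : j \in Q by rewrite !inE eqxx orbT.
have tQ a : (tperm i j a \in Q) = (a \in Q).
  by rewrite !inE; case: tpermP => [-> | -> | //]; rewrite !eqxx ?orbT.
have in_swap T a : (a \in swap T) = (tperm i j a \in T).
  by rewrite -{1}[a](tpermK i j) mem_imset //; apply: perm_inj.
have swapD T : swap T :\: Q = T :\: Q.
  apply/setP=> a; rewrite !(in_setD, in_swap); case: (boolP (a \in Q)) => //=.
  rewrite !inE negb_or => /andP[ai aj].
  by rewrite tpermD // eq_sym.
have swapI T a : T :&: Q = [set a] -> swap T :&: Q = [set tperm i j a].
  move=> TQ; apply/setP=> b; rewrite in_setI in_swap -tQ -in_setI TQ !inE.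
  by rewrite -(inj_eq (@perm_inj _ (tperm i j)) b) tpermK.
pose g := virtual_end Q c.
have loadE (d : {ffun E -> C}) s (T : {set C}) a :
    edge_proper d -> recolors Q c d -> T :&: Q = [set a] ->
    mult d (s, T) = load g d (s, inr (T :\: Q), a).
  by move=> dP cd; apply: mult_load.
have [|c' [s1 [x1]]] := @transfer _ _ _ g c i j s0 (inr (S :\: Q)) ij.
  rewrite -(loadE _ _ _ _ cP (@recolors_refl _ _) SQ).
  have := loadE c s0 (swap S) j cP (@recolors_refl _ _).
  by rewrite swapD (swapI _ _ SQ) tpermL => <-.
set a1 := if _ then j else i; set b1 := if _ then i else j.
have [a1Q b1Q swap1] : [/\ a1 \in Q, b1 \in Q & tperm i j a1 = b1].
  by rewrite /a1 /b1; case: ifP; rewrite ?tpermL ?tpermR.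
move=> [c'E _ lt1 c'load].
have cc' : recolors Q c c'.
  move=> e; case: (boolP (c e \in Q)) => ce.
    by right; case: (c'E e) => ->; rewrite ?tQ.
  left; case: (c'E e) => -> //; move: ce; rewrite !inE negb_or => /andP[? ?].
  by rewrite tpermD // eq_sym.
have load_inl s v a : load g c (s, inl v, a) <= 1.
  rewrite load_fibre; apply/card_le1_eqP => e f; rewrite !inE /g /virtual_end.
  case: ifP => // _ /andP[/eqP[es] /eqP ce].
  case: ifP => // _ /andP[/eqP[fs] /eqP cf].
  by apply: (cP s); rewrite ?es ?ce.
have [e1 [ge1 ce1]] : exists e, g s1 e = x1 /\ c e = a1.
  have := leq_ltn_trans (leq0n _) lt1; rewrite load_fibre => /card_gt0P[e].
  by rewrite inE => /andP[/eqP ge /eqP ce]; exists e.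
pose v1 := ends s1 e1; pose S1 := colors c s1 v1.
have a1S1 : a1 \in S1 by apply/colorsP; exists e1.
have NQS1 : (Q \subset S1) = false.
  apply: contraTF lt1 => QS1; rewrite -leqNgt.
  have x1E : x1 = inl v1 by rewrite -ge1 /g /virtual_end -/v1 -/S1 QS1.
  rewrite x1E (leq_trans (load_inl _ _ _)) // load_fibre card_gt0.
  have /colorsP[f fv cf] : b1 \in S1 by apply: (subsetP QS1).
  by apply/set0Pn; exists f; rewrite inE /g /virtual_end fv -/S1 QS1 cf !eqxx.
have x1E : x1 = inr (S1 :\: Q) by rewrite -ge1 /g /virtual_end -/v1 -/S1 NQS1.
have S1Q : S1 :&: Q = [set a1].
  apply/eqP; rewrite eq_sym eqEcard cards1 sub1set inE a1S1 a1Q -ltnS -Q2 ltnNge.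
  apply: contraFN NQS1 => Qle; apply/setIidPl/eqP; rewrite setIC.
  by rewrite eqEcard subsetIr.
(* A conflict between two edges puts i and j at their vertex, whose class has load
   at most one for each color before the move and therefore after it. *)
have c'P : edge_proper c'.
  move=> s e f ef c'ef; apply/eqP/contraT => nef.
  have cef : c e != c f by apply: contra nef => /eqP /(cP s _ _ ef) ->.
  have ceQ : c e \in Q.
    apply: contraT => ceQ; case/eqP: cef.
    case: (cc' e) => [ce |]; last by rewrite (negPf ceQ).
    case: (cc' f) => [cf |]; last first.
      by rewrite -c'ef (recolors_in _ cc') (negPf ceQ) andbF.
    by rewrite -ce -cf.
  have cfQ : c f \in Q by rewrite -(recolors_in _ cc') -c'ef (recolors_in _ cc').
  have QS : Q \subset colors c s (ends s e).
    have -> : Q = [set c e; c f].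
      apply/eqP; rewrite eq_sym eqEcard cards2 cef Q2 leqnn andbT.
      by apply/subsetP=> a /set2P[] ->.
    by apply/subsetP=> a /set2P[] ->; apply/colorsP; [exists e | exists f].
  pose y : bool * (V + {set C}) * C := (s, inl (ends s e), c' e).
  have := c'load y; rewrite x1E !xpair_eqE /= !andbF !addn0 => loady.
  have := load_inl s (ends s e) (c' e); rewrite -loady load_fibre.
  move/card_le1_eqP/(_ f e) => eqef; case/eqP: nef; apply: eqef;
    by rewrite inE /g /virtual_end -?ef QS -?c'ef !eqxx.
exists c', s1, S1; split=> //.
- rewrite (loadE _ _ _ _ cP (@recolors_refl _ _) S1Q).
  have := loadE c s1 (swap S1) b1 cP (@recolors_refl _ _).
  by rewrite swapD (swapI _ _ S1Q) swap1 -x1E => ->.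
have pairE s T a s' T' a' : T :&: Q = [set a] -> T' :&: Q = [set a'] ->
    ((s, T) == (s', T')) =
    ((s, inr (T :\: Q), a) == (s', inr (T' :\: Q), a')
       :> bool * (V + {set C}) * C).
  move=> TQ T'Q; rewrite !xpair_eqE -andbA; congr (_ && _).
  apply/eqP/andP=> [TT' | [/eqP[TD] /eqP aa']].
    split; first by rewrite TT'.
    by move: T'Q; rewrite -TT' TQ => /set1_inj ->.
  by apply: (@setDI_inj Q) => //; rewrite TQ T'Q aa'.
case=> s T; have [/cards1P[a TQ] | TQ] := boolP (#|T :&: Q| == 1).
  rewrite (loadE _ _ _ _ cP (@recolors_refl _ _) TQ) (loadE _ _ _ _ c'P cc' TQ).
  rewrite (pairE _ _ _ _ _ _ TQ SQ) (pairE _ _ _ _ _ _ TQ S1Q).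
  rewrite (pairE _ _ _ _ _ _ TQ (swapI _ _ SQ)).
  rewrite (pairE _ _ _ _ _ _ TQ (swapI _ _ S1Q)).
  by rewrite !swapD tpermL swap1 -x1E.
have other s' T' a : T' :&: Q = [set a] -> ((s, T) == (s', T')) = false.
  move=> T'Q; apply: contraNF TQ => /eqP[_ ->].
  by rewrite T'Q cards1.
rewrite (other _ _ _ SQ) (other _ _ _ S1Q) (other _ _ _ (swapI _ _ SQ)).
rewrite (other _ _ _ (swapI _ _ S1Q)) !addn0.
apply: recolors_mult cP c'P cc' _.
have : #|T :&: Q| <= 2 by rewrite -Q2 subset_leq_card // subsetIr.
by rewrite Q2 !inE; case: #|_| TQ => [|[|[|?]]].
Qed.

(** * Removing repeated color sets *)

(** Induction on the distance from the repeated set [S] to the hole [S'].  Exchanging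
    [i] in [S] by [j] in [S'] gives a set [S1] closer to [S'].  If the move from [S]
    to [S1] does not decrease the sum of squares, then [S1] was used once and is now
    repeated.  The other end of the path cannot fill [S']: on this side it moves a
    vertex to a set that contains [i], while [i] is not in [S']. *)
Lemma energy_descent c s S S' :
  edge_proper c -> #|S| = #|S'| -> 1 < mult c (s, S) -> mult c (s, S') = 0 ->
  exists2 c' : {ffun E -> C},
    edge_proper c' & energy (mult c') < energy (mult c).
Proof.
have [n] := ubnP #|S :\: S'|; elim: n => // n IHn in c S *.
move=> le_n cP cardS S2 S'0.
have neqS : S != S' by apply: contraTneq S2 => ->; rewrite S'0.
have [i iD] : exists i, i \in S :\: S'.
  apply/set0Pn; apply: contra neqS; rewrite setD_eq0 => sub.
  by rewrite eqEcard sub cardS leqnn.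
have [j jD] : exists j, j \in S' :\: S.
  apply/set0Pn; apply: contra neqS; rewrite setD_eq0 => sub.
  by rewrite eq_sym eqEcard sub cardS leqnn.
move: (iD) (jD); rewrite !inE => /andP[iS' iS] /andP[jS jS'].
have ij : i != j by apply: contraNneq iS' => ->.
set S1 := tperm i j @: S.
have inS1 a : (a \in S1) = (tperm i j a \in S).
  by rewrite -{1}[a](tpermK i j) mem_imset //; apply: perm_inj.
have lt_n : #|S1 :\: S'| < n.
  rewrite -ltnS (leq_trans _ le_n) // ltnS; apply: proper_card; apply/properP.
  split; last by exists i => //; rewrite !inE negb_and negbK inS1 tpermL jS orbT.
  apply/subsetP=> a; rewrite !in_setD inS1 => /andP[aS' aS]; rewrite aS' /=.
  by move: aS aS'; case: tpermP => [-> | -> | //]; rewrite ?jS' ?(negPf jS).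
have cardS1 : #|S1| = #|S'| by rewrite card_imset ?cardS //; apply: perm_inj.
have [S12 | S1_le1] := ltnP 1 (mult c (s, S1)); first exact: (IHn c S1).
have SQ : S :&: [set i; j] = [set i].
  apply/setP=> a; rewrite !inE; case: (a =P i) => [-> | _]; first by rewrite iS.
  by case: (a =P j) => [-> | _]; rewrite ?(negPf jS) ?andbF.
have lt0 := leq_ltn_trans S1_le1 S2.
have [c' [s' [T [c'P TQ lt1 multE]]]] := set_transfer cP ij SQ lt0.
set T1 := tperm i j @: T in lt1 multE.
have swapK (X : {set C}) : tperm i j @: (tperm i j @: X) = X.
  rewrite -imset_comp (eq_imset (g := id)) ?imset_id // => a /=.
  by rewrite tpermK.
have ST : (s, S) != (s', T).
  apply/eqP=> -[es eS]; move: TQ; rewrite -es -eS SQ eqxx => /set1_inj eij.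
  by rewrite eij eqxx in ij.
have S1T1 : (s, S1) != (s', T1).
  apply: contra ST => /eqP[-> eS]; rewrite -(swapK S) -/S1 eS swapK //.
have le_energy := energy_transfer lt0 lt1 ST S1T1 multE.
have [lt_energy | ge_energy] := ltnP (energy (mult c')) (energy (mult c)).
  by exists c'.
have gap : mult c (s, S) <= mult c (s, S1) + 1.
  have := leq_trans le_energy ge_energy.
  by rewrite -[leqRHS]addn0 leq_add2l leqn0 -subn1 subn_eq0 leq_subLR.
have [c'' c''P lt''] : exists2 c'' : {ffun E -> C},
    edge_proper c'' & energy (mult c'') < energy (mult c').
  apply: (IHn c' S1) => //.
    have := multE (s, S1); rewrite eqxx.
    have -> : ((s, S1) == (s', T)) = false.
      apply/eqP=> -[es eS]; move: lt1; rewrite -es -eS /T1 -eS swapK => lt1.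
      by have := ltn_trans lt0 lt1; rewrite ltnn.
    have -> : ((s, S1) == (s, S)) = false.
      by apply/eqP=> -[eS]; move: lt0; rewrite -/S1 eS ltnn.
    rewrite (negPf S1T1) !addn0 => ->.
    exact: leq_trans S2 gap.
  have := multE (s, S'); rewrite S'0.
  have -> : ((s, S') == (s, S1)) = false.
    by apply/eqP=> -[eS]; have := leq_trans S2 gap; rewrite -eS S'0.
  have -> : ((s, S') == (s', T1)) = false.
    apply/eqP=> -[es eS]; move/setP/(_ i): TQ; rewrite -es eqxx !inE eqxx andbT.
    rewrite (negPf ij) => /negP[].
    by move: jS'; rewrite eS /T1 -{1}[j](tpermL i j) (mem_imset _ _ perm_inj).
  by rewrite !addn0 => /eqP; rewrite !addn_eq0 => /andP[/andP[/eqP]].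
by exists c'' => //; apply: leq_trans lt'' (leq_trans (leq_addr _ _) le_energy).
Qed.

End ColorSets.

(** A coloring with the least sum of squares works: if [d]-sets are distributed to
    at most ['C(k, d)] vertices and one set is used twice, another is not used. *)
Lemma distinguishing_coloring_exists (k : nat) :
  (forall s d, #|[set v | #|[set e | ends s e == v]| == d]| <= 'C(k, d)) ->
  exists2 c : {ffun E -> 'I_k}, edge_proper c & forall s, injective (colors c s).
Proof.
move=> degC; have [c0 c0P] : exists c : {ffun E -> 'I_k}, edge_proper c.
  apply: proper_coloring_exists => s v; rewrite -bin_gt0.
  by apply: leq_trans (degC s _); apply/card_gt0P; exists v; rewrite inE.
have [n] := ubnP (energy (mult c0)); elim: n c0 c0P => // n IHn c cP le_n.
case: (boolP [forall s, injectiveb (colors c s)]) => [/forallP inj | ].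
  by exists c => // s; apply/injectiveP.
rewrite negb_forall => /existsP[s /injectivePn[u [v uv cuv]]].
pose S := colors c s u; pose B := [set T : {set 'I_k} | #|T| == #|S|].
have S2 : 1 < mult c (s, S).
  by apply/card_gt1P; exists u, v; rewrite !inE -cuv !eqxx uv.
have [||S' ] := @exists_hole _ B (fun T => mult c (s, T)) S _ _ S2.
- rewrite card_draws card_ord; apply: leq_trans (degC s #|S|).
  rewrite -(card_sum_fibres (h := colors c s) (B := B)) => [|w].
    apply: leq_sum => T; rewrite inE => /eqP cT; apply: subset_leq_card.
    apply/subsetP=> w; rewrite !inE /= => /eqP cw.
    by rewrite -(card_colors s w cP) cw cT !eqxx.
  by rewrite !inE (card_colors s w cP).
- by rewrite inE.
rewrite inE => /eqP/esym cardS S'0.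
have [c' c'P lt_energy] := energy_descent cP cardS S2 S'0.
by apply: (IHn c') => //; apply: leq_trans lt_energy _.
Qed.

End Bipartite.

(** * The bipartite graph of a digraph *)

Section Digraph.
Variables (D : digraph) (k : nat).

Definition arc_end (s : bool) (a : arcs D) : D :=
  if s then tail a else Defs.head a.

Lemma card_arc_end (s : bool) (v : D) :
  #|[set a | arc_end s a == v]| = if s then outdeg v else indeg v.
Proof.
rewrite -(card_in_imset (f := arc_end (~~ s))) => [|a b]; last first.
  rewrite !inE => /eqP <- /eqP ba ab; apply: val_inj.
  case: a b ba ab => [[a1 a2] ?] [[b1 b2] ?].
  by case: s; rewrite /arc_end /tail /Defs.head /= => -> ->.
rewrite /outdeg /indeg; case: s; apply: eq_card => w; rewrite inE.
  apply/imsetP/idP => [[a] | vw].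
    by rewrite inE => /eqP <- ->; apply: (valP a).
  by exists (exist _ (v, w) vw : arcs D); rewrite ?inE /=.
apply/imsetP/idP => [[a] | wv].
  by rewrite inE => /eqP <- ->; apply: (valP a).
by exists (exist _ (w, v) wv : arcs D); rewrite ?inE /=.
Qed.

(** No vertex has a degree outside the two intervals, so the bounds extend to all
    [d]. *)
Lemma binomial_boundsP :
  reflect (forall d, n_out D d <= 'C(k, d) /\ n_in D d <= 'C(k, d))
          (binomial_bounds D k).
Proof.
have range (f : D -> nat) d :
    d \in index_iota (\big[minn/#|D|]_v f v) (\max_v f v).+1 \/
    #|[set v | f v == d]| = 0.
  case: (set_0Vmem [set v | f v == d]) => [-> | [v]].
    by right; rewrite cards0.
  rewrite inE => /eqP <-; left; rewrite mem_index_iota ltnS leq_bigmax andbT.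
  have: v \in index_enum D by exact: mem_index_enum.
  elim: (index_enum D) => // u r IHr; rewrite inE big_cons geq_min.
  by case/predU1P=> [-> | /IHr ->]; rewrite ?leqnn ?orbT.
apply: (iffP andP) => [[/allP bo /allP bi] d | b].
  split.
    by have [/bo // | d0] := range (@outdeg D) d; rewrite /n_out d0.
  by have [/bi // | d0] := range (@indeg D) d; rewrite /n_in d0.
by split; apply/allP=> d _; case: (b d).
Qed.

Lemma vd_colorableP :
  reflect (exists2 c : {ffun arcs D -> 'I_k},
             edge_proper arc_end c & forall s, injective (colors arc_end c s))
          (vd_colorable D k).
Proof.
apply: (iffP existsP) => [[c /andP[ac vd]] | [c cP inj]]; exists c.
- move=> s a b ab cab; apply/eqP/contraT => nab.
  move/forallP/(_ a)/forallP/(_ b)/implyP: ac; rewrite nab cab eqxx /=.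
  by case: s ab => /= ->; rewrite eqxx ?orbT => /(_ isT).
- move=> s u v cuv; apply/eqP/contraT => uv.
  move/forallP/(_ u)/forallP/(_ v)/implyP: vd => /(_ uv).
  by case: s cuv => /eqP cuv /andP[]; rewrite cuv.
apply/andP; split.
  apply/forallP=> a; apply/forallP=> b; apply/implyP=> /andP[ab tab].
  apply: contra ab => /eqP cab; apply/eqP.
  by case/orP: tab => /eqP tab; [apply: (cP true) | apply: (cP false)].
apply/forallP=> u; apply/forallP=> v; apply/implyP=> uv; apply/andP; split.
  by apply: contra uv => /eqP/(inj true) ->.
by apply: contra uv => /eqP/(inj false) ->.
Qed.

Lemma vd_colorableE : vd_colorable D k = binomial_bounds D k.
Proof.
apply/vd_colorableP/binomial_boundsP => [[c cP inj] d | b].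
  have bound s :
      #|[set v | #|[set a | arc_end s a == v]| == d]| <= 'C(k, d).
    rewrite -(card_imset _ (inj s)) -[k in 'C(k, d)]card_ord -card_draws.
    apply/subset_leq_card/subsetP=> S /imsetP[v]; rewrite !inE => dv ->.
    by rewrite card_colors.
  split; [have := bound true | have := bound false];
    apply: leq_trans; apply/subset_leq_card/subsetP=> v; rewrite !inE.
    by rewrite card_arc_end.
  by rewrite card_arc_end.
apply: distinguishing_coloring_exists => -[] d; have [bo bi] := b d.
  apply: leq_trans bo; apply/subset_leq_card/subsetP=> v.
    by rewrite !inE card_arc_end.
apply: leq_trans bi; apply/subset_leq_card/subsetP=> v.
  by rewrite !inE card_arc_end.
Qed.

End Digraph.

Theorem theorem1p3 (D : digraph)
  (Dsource : #|sources D| <= 1) (Dsink : #|sinks D| <= 1) :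
  chi_vd Dsource Dsink = k_bound Dsource Dsink.
Proof.
apply: eq_ex_minn => k; exact: vd_colorableE.
Qed.
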